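(* For all positive integers $k$, $n$ and $\delta$, $$\Phi_k(n)\le\left(\frac{\delta\,(1+\tau)\,k!}{\zeta(k,\delta)}\right)^{1/k} n^{1/k}+\frac{e-1}{e}\,k,$$ where $\tau=0$ if $k$ is even and $\tau=1$ if $k$ is odd.
   Context: A finite set $\mathcal A$ of non-negative integers is a $B_k$-sequence if all sums $a_1+\dots+a_k$ of $k$ elements of $\mathcal A$ (repetitions allowed) are different, i.e. distinct multisets $\{a_1,\dots,a_k\}$ of elements of $\mathcal A$ have distinct sums. $\Phi_k(n)$ is the maximum size of a $B_k$-sequence contained in $[0,n]$. For positive integers $m$ and $\delta$, a $\delta$-deviation set of size $m$ is a finite sequence $(\alpha_1,\dots,\alpha_\ell)$ of positive integers such that (i) $\sum_i\alpha_i=m$; (ii) $\big|\sum_i\alpha_{2i-1}-\sum_i\alpha_{2i}\big|\le 1$; (iii) $\big|\sum_{1\le i\le j}(-1)^{i-1}\alpha_i\big|\le\delta$ for every $j\ge1$; and $\zeta(m,\delta)$ is the number of $\delta$-deviation sets of size $m$. *)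

(* Defs.v *)
From mathcomp Require Import all_boot all_order all_algebra.
Set Implicit Arguments. Unset Strict Implicit. Unset Printing Implicit Defensive.
Import Order.TTheory GRing.Theory Num.Theory.

(* A subset A of [0,n] (elements are ordinals 'I_(n.+1), read through val) is a
   B_k-sequence iff any two k-element multisets of elements of A (represented
   as k-tuples, multisets = tuples up to permutation) with equal sums are equal
   as multisets. *)
Definition Bk (k n : nat) (A : {set 'I_n.+1}) : bool :=
  [forall t1 : k.-tuple 'I_n.+1, forall t2 : k.-tuple 'I_n.+1,
     [&& all (mem A) t1, all (mem A) t2 &
         sumn (map val t1) == sumn (map val t2)] ==> perm_eq t1 t2].

Definition Phi (k n : nat) : nat :=
  \max_(A : {set 'I_n.+1} | Bk k A) #|A|.

Definition altsum (s : seq nat) (j : nat) : int :=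
  (\sum_(i < j) (-1) ^+ i * ((nth 0%N s i)%:Z))%R.

Definition deviation_set (m delta : nat) (s : seq nat) : bool :=
  [&& all (fun a => 0 < a)%N s,
      sumn s == m,
      (`|altsum s (size s)| <= 1)%R &
      [forall j : 'I_(size s).+1, (`|altsum s j| <= delta%:Z)%R]].

(* zeta(m,delta): number of delta-deviation sets of size m; a sequence of
   positive integers summing to m has length l <= m and entries <= m. *)
Definition zeta (m delta : nat) : nat :=
  \sum_(l < m.+1) #|[set t : l.-tuple 'I_m.+1 | deviation_set m delta (map val t)]|.

Definition tau (k : nat) : nat := if odd k then 1 else 0.

(* Main.v *)
(** Reading a deviation set as the run lengths of a word of signs turns it into a
    sign pattern of length k that starts with +, has all prefix heights in
    [-delta, delta] and total height 0 or +-1.  For b_1 < ... < b_k in A and a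
    sign pattern, the signed sum of the b_i determines both: an equality
    P - M = P' - M' of signed sums reads P + M' = P' + M, an equality of sums of
    k elements of A.  By Abel summation the signed sums, normalized by the overall
    sign, lie in an interval with delta (1 + tau) n integers, hence
    C(|A|, k) zeta <= delta (1 + tau) n.

    If |A| >= k, it remains to bound the falling factorial below:
    (t+1)...(t+k) >= (t + k/e)^k.  If |A| = k - m with m > 0, counting all
    k-element sums of A gives 2^|A| <= 4 n, so zeta <= 2^(k-1) <= 4^m n, while
    (|A| - (1 - 1/e) k)^k = (k/e)^k (1 - e m / k)^k <= k! exp(- e m) <= k! / 4^m. *)

Require Import Defs.
From mathcomp Require Import all_boot all_order all_algebra zify.
Set Implicit Arguments. Unset Strict Implicit. Unset Printing Implicit Defensive.
Import Order.TTheory GRing.Theory Num.Theory.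

(** * Signed sums and heights of words of signs *)

Section SignPatterns.
Local Open Scope ring_scope.

Definition sg (x : bool) : int := if x then 1 else -1.

Definition height (p : seq bool) : int := (count_mem true p)%:Z - (count_mem false p)%:Z.

(** Masks keep the plus part and the minus part available as sublists, which the multiset argument
    needs; [signed_sum_cons] recovers the termwise form. *)
Definition signed_sum (p : seq bool) (b : seq nat) : int :=
  (sumn (mask p b))%:Z - (sumn (mask (map negb p) b))%:Z.

Lemma height_cons x p : height (x :: p) = sg x + height p.
Proof. by case: x; rewrite /height /sg /=; lia. Qed.

Lemma height_negb p : height (map negb p) = - height p.
Proof.
by elim: p => // x p IH; rewrite /= !height_cons IH; case: x; rewrite /sg /=; lia.
Qed.

Lemma height_cat p q : height (p ++ q) = height p + height q.
Proof. by rewrite /height !count_cat; lia. Qed.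

Lemma height_nseq a x : height (nseq a x) = sg x * a%:Z.
Proof. by rewrite /height !count_nseq; case: x; rewrite /sg /=; lia. Qed.

Lemma signed_sum_cons x p y b :
  signed_sum (x :: p) (y :: b) = sg x * y%:Z + signed_sum p b.
Proof. by case: x; rewrite /signed_sum /sg /=; lia. Qed.

Lemma signed_sum_negb p b : signed_sum (map negb p) b = - signed_sum p b.
Proof.
by rewrite /signed_sum (mapK negbK); lia.
Qed.

(* Abel summation, with the heights shifted by [h] to make the induction work. *)
Lemma signed_sum_bound (delta : nat) h (y : nat) p b :
  size p = size b -> path leq y b ->
  (forall i, (i <= size p)%N -> `|h + height (take i p)| <= delta%:Z) ->
  `|h * y%:Z + signed_sum p b - (h + height p) * (last y b)%:Z|
    <= delta%:Z * ((last y b)%:Z - y%:Z).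
Proof.
elim: p h y b => [|x p IH] h y [|z b] //=.
  by move=> _ _ _; rewrite /signed_sum /height /=; lia.
move=> [sz] /andP[yz zb] bd.
have {}IH := IH (h + sg x) z b sz zb.
have bh : `|h| <= delta%:Z by have := bd 0%N isT; rewrite /height /=; lia.
have {}IH : `|(h + sg x) * z%:Z + signed_sum p b - (h + sg x + height p) * (last z b)%:Z|
    <= delta%:Z * ((last z b)%:Z - z%:Z).
  apply: IH => i ip; have := bd i.+1 ip; rewrite /= height_cons; lia.
rewrite signed_sum_cons height_cons.
(* The term of the Abel sum that is split off: the gap from [y] to [z], weighted by the current
   height. *)
have e1 : `|h * (z%:Z - y%:Z)| <= delta%:Z * (z%:Z - y%:Z).
  by rewrite normrM (ger0_norm (x := z%:Z - y%:Z)) ?ler_wpM2r //; lia.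
lia.
Qed.

(* The first two heights cannot both have absolute value [delta]; for odd [k] the
   resulting gain of 1 leaves [2 * delta * n] possible values, not one more. *)
Lemma signed_sum_bound_lt (delta : nat) p b :
  size p = size b -> (2 < size p)%N -> sorted ltn b ->
  (forall i, (i <= size p)%N -> `|height (take i p)| <= delta%:Z) ->
  `|signed_sum p b - height p * (last 0%N b)%:Z| + 1
    <= delta%:Z * ((last 0%N b)%:Z - (head 0%N b)%:Z).
Proof.
case: p => [|x0 [|x1 [|x2 p]]] //; case: b => [|b0 [|b1 [|b2 b]]] //= [sz] _.
move=> /and3P[l01 l12 pb] bd.
have bd1 := bd 1%N isT; have bd2 := bd 2%N isT.
have bd3 i : (i <= size p)%N -> `|sg x0 + sg x1 + sg x2 + height (take i p)| <= delta%:Z.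
  by move=> ip; have := bd i.+3 ip; rewrite /= !height_cons; lia.
have := signed_sum_bound sz (sub_path (fun x y => @ltnW x y) pb) bd3.
rewrite !signed_sum_cons !height_cons.
move: bd1 bd2 {bd bd3}; rewrite /= !height_cons.
rewrite (_ : height [::] = 0) //.
set S := signed_sum _ _; set H := height _; set L := last _ _.
move=> bd1 bd2 B3.
have e1 : `|sg x0 * (b1%:Z - b0%:Z)| = b1%:Z - b0%:Z.
  by case: (x0); rewrite /sg; lia.
have {bd1}d1 : (0 < delta)%N by move: bd1; case: (x0); rewrite /sg; lia.
(* If the second height is 0, the gap [b1 < b2] yields the gain of 1. If it is 2 or -2, then [delta]
   is at least 2 while the first height is 1 or -1, so the gap [b0 < b1] yields it. *)
have e2 : `|(sg x0 + sg x1) * (b2%:Z - b1%:Z)| + 1 + (b1%:Z - b0%:Z)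
     <= delta%:Z * (b2%:Z - b0%:Z).
  by move: bd2; case: (x0); case: (x1); rewrite /sg /=; nia.
lia.
Qed.

(** * Recovering a subset and its signs from a signed sum *)

Lemma count_mask_negb (T : Type) (a : pred T) p s :
  size p = size s -> (count a (mask p s) + count a (mask (map negb p) s) = count a s)%N.
Proof. by elim: p s => [|[] p IH] [|y s] //= [/IH <-]; lia. Qed.

Lemma size_mask_height (T : Type) p (s : seq T) : size p = size s ->
  (size (mask p s))%:Z - (size (mask (map negb p) s))%:Z = height p.
Proof.
elim: p s => [|x p IH] [|y s] //= [/IH]; rewrite height_cons => <-.
by case: x; rewrite /sg /=; lia.
Qed.

Lemma mask_memK (T : eqType) p (s : seq T) : uniq s -> size p = size s ->
  [seq x \in mask p s | x <- s] = p.
Proof.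
move=> us sz; apply: (@eq_from_nth _ false); first by rewrite size_map.
rewrite size_map => i si; have [x0 _] : exists x0 : T, True by case: (s) si => // x; exists x.
by rewrite (nth_map x0) // in_mask // mem_nth // index_uniq.
Qed.

Lemma Bk_perm k n (A : {set 'I_n.+1}) (s1 s2 : seq 'I_n.+1) :
  Bk k A -> size s1 = k -> size s2 = k -> {subset s1 <= A} -> {subset s2 <= A} ->
  sumn (map val s1) = sumn (map val s2) -> perm_eq s1 s2.
Proof.
move=> /forallP BA z1 z2 /allP m1 /allP m2 e.
have /forallP/(_ (Tuple (introT eqP z2))) /= := BA (Tuple (introT eqP z1)).
by rewrite m1 m2 e eqxx.
Qed.

(* Equal heights make [P + M'] and [P' + M] sums of exactly [k] elements, where
   [P], [M] are the elements of [B] counted with sign [+], [-]. *)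
Lemma signed_sum_inj (T : finType) (v : T -> nat) k (A B B' : {set T}) p p' :
  (forall s1 s2 : seq T, size s1 = k -> size s2 = k -> {subset s1 <= A} ->
    {subset s2 <= A} -> sumn (map v s1) = sumn (map v s2) -> perm_eq s1 s2) ->
  B \subset A -> B' \subset A -> #|B| = k -> #|B'| = k ->
  size p = k -> size p' = k -> height p = height p' ->
  signed_sum p (map v (enum B)) = signed_sum p' (map v (enum B')) ->
  B = B' /\ p = p'.
Proof.
move=> BA /subsetP sB /subsetP sB' cB cB' zp zp' hh.
have sz : size p = size (enum B) by rewrite -cardE cB.
have sz' : size p' = size (enum B') by rewrite -cardE cB'.
rewrite /signed_sum -!map_mask.
set P := mask p _; set M := mask _ (enum B); set P' := mask p' _; set M' := mask _ (enum B').
move=> ee.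
have PB : {subset P <= enum B} by move=> x; exact: mem_mask.
have MB : {subset M <= enum B} by move=> x; exact: mem_mask.
have PB' : {subset P' <= enum B'} by move=> x; exact: mem_mask.
have MB' : {subset M' <= enum B'} by move=> x; exact: mem_mask.
have := size_mask_height sz; have := size_mask_height sz'; rewrite -/P -/M -/P' -/M'.
have := count_mask_negb predT sz; have := count_mask_negb predT sz'.
rewrite !count_predT -sz -sz' zp zp' -/P -/M -/P' -/M' => c' c h' h.
have pe : perm_eq (P ++ M') (P' ++ M).
  apply: BA; rewrite ?size_cat ?map_cat ?sumn_cat; try lia.
    by move=> x; rewrite mem_cat => /orP[/PB|/MB']; rewrite mem_enum; [apply: sB|apply: sB'].
  by move=> x; rewrite mem_cat => /orP[/PB'|/MB]; rewrite mem_enum; [apply: sB'|apply: sB].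
(* Each of [P], [M] and [P'], [M'] is a disjoint pair of duplicate-free lists, so [P + M' = P' + M]
   leaves no other choice of multiplicities. *)
have cnt x : count_mem x P = count_mem x P' /\ count_mem x M = count_mem x M'.
  have /permP/(_ (pred1 x)) := pe; rewrite !count_cat.
  have := count_mask_negb (pred1 x) sz; have := count_mask_negb (pred1 x) sz'.
  rewrite -/P -/M -/P' -/M' !(count_uniq_mem x (enum_uniq _)).
  by case: (_ \in _); case: (_ \in _) => /=; lia.
have eB : B = B'.
  apply/setP => x; rewrite -(mem_enum B) -(mem_enum B') -!has_pred1 !has_count.
  rewrite -(count_mask_negb (pred1 x) sz) -(count_mask_negb (pred1 x) sz').
  by rewrite -/P -/M -/P' -/M'; case: (cnt x) => -> ->.
split=> //; rewrite -(mask_memK (enum_uniq B) sz) -/P -(mask_memK (enum_uniq B') sz').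
rewrite -/P' -eB; apply: eq_map => x; rewrite -!has_pred1 !has_count.
by case: (cnt x) => ->.
Qed.

(** * Counting signed sums over a B_k-sequence *)

Definition sign_patterns k delta : {set k.-tuple bool} :=
  [set p : k.-tuple bool | [&& head false p, `|height p| <= 1
     & [forall i : 'I_k.+1, `|height (take i p)| <= delta%:Z]]].

Lemma height_parity k (p : k.-tuple bool) : `|height p| <= 1 ->
  if odd k then height p = 1 \/ height p = -1 else height p = 0.
Proof.
have cnt (s : seq bool) : (count_mem true s + count_mem false s = size s)%N.
  by elim: s => // -[] s /= <-; lia.
by have := cnt p; rewrite size_tuple /height; case: ifP; lia.
Qed.

Lemma card_le_of_inj (T : finType) (W : {set T}) (f : T -> nat) m :
  {in W, forall x, (f x < m)%N} -> {in W &, injective f} -> (#|W| <= m)%N.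
Proof.
move=> fm fI; rewrite cardE -(size_map f) -(size_iota 0 m).
apply: uniq_leq_size.
  by rewrite map_inj_in_uniq ?enum_uniq // => x y; rewrite !mem_enum; apply: fI.
by move=> y /mapP[x xW ->]; rewrite mem_iota fm // -mem_enum.
Qed.

Lemma sorted_enum_ord n (B : {set 'I_n}) : sorted ltn (map val (enum B)).
Proof.
rewrite sorted_map /enum_mem.
suff s : sorted (relpre val ltn) (Finite.enum 'I_n).
  by apply: sorted_filter s => y x z /=; exact: ltn_trans.
by rewrite -enumT -sorted_map val_enum_ord iota_ltn_sorted.
Qed.

Lemma last_ltn m n (b : seq nat) : (m < n)%N -> {in b, forall y, (y < n)%N} ->
  (last m b < n)%N.
Proof. by move=> mn bn; have := mem_last m b; rewrite inE => /orP[/eqP->|/bn]. Qed.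

(** The second conclusion excludes coincidences up to an overall sign: they would identify [p] with
    the negation of [p'], but both words start with a plus. *)
Lemma sign_patterns_inj k n delta (A B B' : {set 'I_n.+1}) (p p' : k.-tuple bool) :
  (0 < k)%N -> Bk k A -> B \subset A -> B' \subset A -> #|B| = k -> #|B'| = k ->
  p \in sign_patterns k delta -> p' \in sign_patterns k delta ->
  let D := signed_sum p (map val (enum B)) in
  let D' := signed_sum p' (map val (enum B')) in
  (height p = height p' -> D = D' -> (B, p) = (B', p')) /\
  ~ (height p = - height p' /\ D = - D').
Proof.
move=> k0 BA sB sB' cB cB' gp gp' /=.
have key q' : size q' = k -> height p = height q' ->
  signed_sum p (map val (enum B)) = signed_sum q' (map val (enum B')) -> B = B' /\ val p = q'.
  move=> zq hh e.
  by apply: (signed_sum_inj (k := k) (fun s1 s2 => Bk_perm BA) sB sB'); rewrite ?size_tuple.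
split; first by move=> hh e; case: (key p' (size_tuple _) hh e) => -> /val_inj ->.
case; rewrite -height_negb -signed_sum_negb => hh e.
have [|_] := key _ _ hh e; first by rewrite size_map size_tuple.
move: gp gp'; rewrite !inE => /and3P[h _ _] /and3P[h' _ _].
by case: p p' h h' {hh e key} => -[|[] p] zp [[|[] p'] zp'].
Qed.

(** After multiplication by [h] the values are centred at [l1], hence lie between
    [- (delta - 1) * n] and [(delta + 1) * n]; the extra 1 excludes the upper end. The alternative
    [l0 = l1] serves [k = 1], where there is no gain. *)
Lemma normalized_value_range (delta n l0 l1 : nat) (h D : int) :
  (0 < delta)%N -> (0 < n)%N -> (l0 <= l1)%N -> (l1 <= n)%N -> h = 1 \/ h = -1 ->
  `|D - h * l1%:Z| <= delta%:Z * (l1%:Z - l0%:Z) ->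
  l0 = l1 \/ `|D - h * l1%:Z| + 1 <= delta%:Z * (l1%:Z - l0%:Z) ->
  0 <= h * D + (delta.-1 * n)%:Z < (2 * (delta * n))%:Z.
Proof.
case: delta => // d _ n0 l01 l1n hh; rewrite /=.
have : (d * l1 <= d * n)%N by rewrite leq_mul.
have : (0 <= d * l0)%N by [].
have -> : d.+1%:Z * (l1%:Z - l0%:Z) = (d * l1)%:Z + l1%:Z - (d * l0)%:Z - l0%:Z by lia.
by rewrite mulSn; case: hh => -> e0 e1 b1 [e|b2]; rewrite ?e in b1 *; lia.
Qed.

Lemma card_sign_patterns k n delta (A : {set 'I_n.+1}) :
  (0 < k)%N -> (0 < n)%N -> (0 < delta)%N -> Bk k A ->
  ('C(#|A|, k) * #|sign_patterns k delta| <= (tau k).+1 * (delta * n))%N.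
Proof.
move=> k0 n0 d0 BA; rewrite -cards_draws -cardsX.
pose X := ({set 'I_n.+1} * k.-tuple bool)%type.
pose D (x : X) := signed_sum x.2 (map val (enum x.1)).
(* For odd [k] the height is a sign that normalizes [D]. For even [k] it is 0, so the absolute value
   normalizes; it is nonzero, and the predecessor moves it to a range starting at 0. *)
pose f (x : X) := if odd k then `|(height x.2 * D x + (delta.-1 * n)%:Z)%R|%N else `|D x|%N.-1.
set W := setX _ _.
have WP (x : X) : x \in W -> [/\ x.1 \subset A, #|x.1| = k & x.2 \in sign_patterns k delta].
  by case: x => B p; rewrite !inE => /andP[/andP[? /eqP ?] ?].
have inj (x y : X) : x \in W -> y \in W ->
  (height x.2 = height y.2 -> D x = D y -> x = y) /\
  ~ (height x.2 = - height y.2 /\ D x = - D y).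
  case: x => B p /WP[sB cB gp]; case: y => B' p' /WP[sB' cB' gp'].
  exact: (sign_patterns_inj k0 BA sB sB' cB cB' gp gp').
have par (x : X) : x \in W ->
    if odd k then height x.2 = 1 \/ height x.2 = -1 else height x.2 = 0.
  by case/WP => _ _; rewrite inE => /and3P[_ + _]; exact: height_parity.
have bnd (x : X) : x \in W -> exists l0 l1 : nat, [/\ (l0 <= l1)%N, k = 1%N -> l0 = l1, (l1 <= n)%N,
    `|D x - height x.2 * l1%:Z| <= delta%:Z * (l1%:Z - l0%:Z) &
    (if odd k then k != 1%N else false) ->
      `|D x - height x.2 * l1%:Z| + 1 <= delta%:Z * (l1%:Z - l0%:Z)].
  case/WP => sB cB; rewrite inE => /and3P[_ _ /forallP hb].
  have {}hb i : (i <= size x.2)%N -> `|height (take i x.2)| <= delta%:Z.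
    by rewrite size_tuple => ik; have := hb (Ordinal (ik : (i < k.+1)%N)).
  have zb : size x.2 = size (map val (enum x.1)) by rewrite size_tuple size_map -cardE cB.
  have bn : {in map val (enum x.1), forall y, (y < n.+1)%N}.
    by move=> z /mapP[y _ ->]; exact: ltn_ord.
  have sb := sorted_enum_ord x.1.
  have lb := signed_sum_bound_lt zb _ sb hb.
  rewrite /D; move: zb bn sb lb; set b := map val _ => zb bn sb lb.
  (* The least and the largest element of the chosen subset. *)
  exists (head 0%N b), (last 0%N b); split.
  - case: (b) sb => //= y s ys; have /allP ls := order_path_min ltn_trans ys.
    by have := mem_last y s; rewrite inE => /orP[/eqP-> //|/ls /ltnW].
  - by move=> k1; move: zb; rewrite size_tuple k1; case: (b) => [|? []].
  - by have := last_ltn (ltn0Sn n) bn; rewrite ltnS.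
  - have -> : last 0%N b = last (head 0%N b) b by case: (b).
    have := @signed_sum_bound delta 0 (head 0%N b) _ _ zb; rewrite mul0r !add0r; apply.
      by case: (b) sb => //= y s ys; rewrite leqnn (sub_path _ ys) // => ? ?; exact: ltnW.
    by move=> i; rewrite add0r; exact: hb.
  - by move=> ok; apply: lb; rewrite size_tuple; move: ok; case: ifP => //; lia.
have rng (x : X) : x \in W -> odd k ->
    0 <= height x.2 * D x + (delta.-1 * n)%:Z < (2 * (delta * n))%:Z.
  move=> xW ok; have [l0 [l1 [l01 k1 l1n b1 b2]]] := bnd x xW.
  have h := par x xW; rewrite ok in b2 h.
  apply: (@normalized_value_range _ _ l0 l1) => //.
  by case: (k =P 1%N) b2 => [/k1|_ /(_ isT)]; [left|right].
(* At height 0, a vanishing signed sum would be opposite to itself, which [inj] forbids for the pair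
   [x], [x]. *)
have pos (x : X) : x \in W -> ~~ odd k -> D x != 0.
  move=> xW ok; have := par x xW; rewrite (negbTE ok) => h.
  by apply/eqP => D0; have [_] := inj x x xW xW; rewrite h D0; apply; split; lia.
have fm (x : X) : x \in W -> (f x < (tau k).+1 * (delta * n))%N.
  move=> xW; rewrite /f /tau; case: ifP => ok; first by have := rng x xW ok; lia.
  have := pos x xW; rewrite ok => /(_ isT) D0.
  have [l0 [l1 [l01 k1 l1n b1 b2]]] := bnd x xW.
  have := par x xW; rewrite ok => h; rewrite h in b1.
  have e1 : (delta * l1 <= delta * n)%N by rewrite leq_mul.
  by lia.
have fI (x y : X) : x \in W -> y \in W -> f x = f y -> x = y.
  move=> xW yW; rewrite /f; have := par x xW; have := par y yW; have := inj x y xW yW.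
  case: ifP => ok [I1 I2].
    have := rng x xW ok; have := rng y yW ok => ry rx hy hx e.
    have {rx ry}e : height x.2 * D x = height y.2 * D y by lia.
    case: hx hy => hx [] hy; rewrite hx hy in e; apply: I1; lia.
  have := pos x xW; have := pos y yW; rewrite ok => /(_ isT) Dy /(_ isT) Dx hy hx e.
  by apply: I1; lia.
by apply: (card_le_of_inj fm) => x y; exact: fI.
Qed.

(** * From deviation sets to sign patterns *)

Fixpoint expand_runs (x : bool) (s : seq nat) : seq bool :=
  if s is a :: s' then nseq a x ++ expand_runs (~~ x) s' else [::].

Lemma size_expand_runs x s : size (expand_runs x s) = sumn s.
Proof. by elim: s x => //= a s IH x; rewrite size_cat size_nseq IH. Qed.

Lemma altsum0 s : altsum s 0 = 0.
Proof. exact: big_ord0. Qed.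

Lemma altsum_cons a s j : altsum (a :: s) j.+1 = a%:Z - altsum s j.
Proof.
rewrite /altsum big_ord_recl expr0 mul1r /=; congr (_ + _).
by rewrite -sumrN; apply: eq_bigr => i _; rewrite exprS -mulrA mulN1r.
Qed.

Lemma sgN x : sg (~~ x) = - sg x.
Proof. by case: x. Qed.

Lemma height_expand_runs x s : height (expand_runs x s) = sg x * altsum s (size s).
Proof.
elim: s x => [|a s IH] x /=; first by rewrite altsum0 mulr0.
by rewrite height_cat height_nseq IH altsum_cons sgN; lia.
Qed.

(** Inside a run the height is monotone, so a bound at the ends of the runs extends to all prefixes.
    The offset [h] carries the height reached before the current run. *)
Lemma height_take_expand_runs (delta : nat) h x s :
  (forall j, (j <= size s)%N -> `|h + sg x * altsum s j| <= delta%:Z) ->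
  forall i, `|h + height (take i (expand_runs x s))| <= delta%:Z.
Proof.
elim: s h x => [|a s IH] h x bd i.
  by have := bd 0%N isT; rewrite altsum0 mulr0.
have := bd 0%N isT; have := bd 1%N isT; rewrite altsum_cons !altsum0 subr0 => b1 b0.
rewrite /= take_cat size_nseq; case: ltnP => ia.
  have -> : take i (nseq a x) = nseq i x.
    by rewrite -(subnKC (ltnW ia)) nseqD take_size_cat ?size_nseq.
  by rewrite height_nseq; move: b0 b1; case: (x); rewrite /sg; lia.
rewrite height_cat height_nseq addrA; apply: IH => j js.
by have := bd j.+1 js; rewrite altsum_cons sgN; lia.
Qed.

(** The first run ends where the opposite sign first occurs, or at the end of the word; positivity
    of the next run makes this position exact. *)
Lemma expand_runs_inj x : {in all (leq 1) &, injective (expand_runs x)}.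
Proof.
move=> s; elim: s x => [|a s IH] x [|a' s'] //=.
- by rewrite /in_mem /= => _ /andP[]; case: a'.
- by rewrite /in_mem /= => /andP[]; case: a.
have fnd b t : all (leq 1) t -> find (pred1 (~~ x)) (nseq b x ++ expand_runs (~~ x) t) = b.
  move=> t0; rewrite find_cat has_nseq size_nseq /= (_ : (x == ~~ x) = false) ?andbF; last by case: (x).
  by case: t t0 => [|[|c] t] //= _; rewrite ?eqxx ?addn0.
rewrite /in_mem /= => /andP[_ s0] /andP[_ s0'] e.
have ea : a = a' by rewrite -(fnd a s s0) e fnd.
move: e; rewrite ea => /eqP; rewrite eqseq_cat ?size_nseq // eqxx => /eqP e.
by rewrite (IH _ _ s0 s0' e).
Qed.

Lemma zeta_le_card k delta : (0 < k)%N -> (zeta k delta <= #|sign_patterns k delta|)%N.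
Proof.
move=> k0; rewrite /zeta.
under eq_bigr do rewrite -sum1_card.
(* The sum over lengths becomes a count of dependent pairs of a length and a tuple of that
   length. *)
rewrite (sig_big_dep _ (fun (l : 'I_k.+1) t => t \in [set t : l.-tuple 'I_k.+1 | deviation_set k delta (map val t)])
  (fun _ _ => 1%N)) /=.
rewrite sum1dep_card.
set S := [set x | _].
(* The default all-minus word is never reached on [S], where the expanded word has length [k]. *)
pose f (x : {l : 'I_k.+1 & l.-tuple 'I_k.+1}) : k.-tuple bool :=
  insubd [tuple of nseq k false] (expand_runs true (map val (tagged x))).
have SP (x : {l : 'I_k.+1 & l.-tuple 'I_k.+1}) : x \in S -> deviation_set k delta (map val (tagged x)).
  by rewrite !inE.
have fE (x : {l : 'I_k.+1 & l.-tuple 'I_k.+1}) : x \in S -> f x = expand_runs true (map val (tagged x)) :> seq bool.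
  move=> /SP /and4P[_ /eqP s _ _]; rewrite /f val_insubd.
  by rewrite size_expand_runs s eqxx.
have fI : {in S &, injective f}.
  move=> x y xS yS exy; have := congr1 val exy; rewrite /= !fE //.
  move: xS yS => /SP /and4P[px _ _ _] /SP /and4P[py _ _ _] e.
  have {px py e exy} := expand_runs_inj px py e.
  case: x y => [l t] [l' t'] /= e.
  have ll : l = l' by apply: val_inj; have := congr1 size e; rewrite !size_map !size_tuple.
  by move: t' e; rewrite -ll => t' /(inj_map val_inj) /val_inj ->.
rewrite -(card_in_imset fI); apply: subset_leq_card; apply/subsetP => _ /imsetP[x xS ->].
rewrite inE fE //; have /and4P[p s a /forallP bd] := SP x xS.
move: p s a bd; set s := map val _ => p /eqP sk a bd.
apply/and3P; split.
- by case: s p sk {a bd} => [|[|c] s] //= _ k00; rewrite -k00 in k0.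
- by rewrite height_expand_runs /sg mul1r.
- apply/forallP => i; rewrite -[height _]add0r; apply: height_take_expand_runs => j js.
  by have := bd (Ordinal (js : (j < (size s).+1)%N)); rewrite add0r /sg mul1r.
Qed.

(** The sequence of [k] ones is a deviation set: its partial alternating sums are 0 or 1. This
    justifies dividing by [zeta]. *)
Lemma zeta_gt0 k delta : (0 < delta)%N -> (0 < zeta k delta)%N.
Proof.
move=> d0; have a01 m j : 0 <= altsum (nseq m 1%N) j <= 1.
  elim: m j => [|m IH] [|j]; rewrite ?altsum0 //.
    by rewrite /altsum big1 // => i _; rewrite nth_nil mulr0.
  by rewrite /= altsum_cons; have := IH j; lia.
rewrite /zeta (bigD1 ord_max) //= ltn_addr // card_gt0; apply/set0Pn.
exists [tuple of nseq k (inord 1)]; rewrite inE /=.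
have -> : map val (nseq k (inord 1 : 'I_k.+1)) = nseq k 1%N.
  by case: k => // k; rewrite map_nseq /= inordK.
apply/and4P; split.
- by rewrite all_nseq orbT.
- by rewrite sumn_nseq mul1n.
- by have := a01 k (size (nseq k 1%N)); lia.
- by apply/forallP => j; have := a01 k j; lia.
Qed.

(** The first sign is forced, and at most the other [k] are free. *)
Lemma card_sign_patterns_le k delta : (#|sign_patterns k.+1 delta| <= 2 ^ k)%N.
Proof.
rewrite -card_bool -(card_tuple k).
have <- : #|[set [tuple of true :: t] | t : k.-tuple bool]| = #|{: k.-tuple bool}|.
  by rewrite card_imset // => t t' /(congr1 val) [] /val_inj.
apply: subset_leq_card; apply/subsetP => p; rewrite inE => /and3P[hp _ _].
apply/imsetP; exists (behead_tuple p) => //; apply: val_inj.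
by case: p hp => [[|[] p] ?].
Qed.

End SignPatterns.

(** * B_k-sequences with fewer than [k] elements *)

Lemma Bk_card_bound k n (A : {set 'I_n.+1}) m : Bk k A -> #|A| = m.+1 ->
  'C(k + m, k) <= (k * n).+1.
Proof.
(* Sorted tuples of indices represent the [k]-element multisets of [A], whose distinct sums lie in
   [[0, k * n]]. *)
move=> BA cA; rewrite -card_sorted_tuples.
pose e (i : 'I_m.+1) := nth ord0 (enum A) i.
have sE (i : 'I_m.+1) : i < size (enum A) by rewrite -cardE cA.
have eI : injective e.
  by move=> i j /eqP; rewrite nth_uniq ?enum_uniq // => /eqP/val_inj.
have eA i : e i \in A by rewrite -mem_enum mem_nth.
pose f (t : k.-tuple 'I_m.+1) := sumn (map val (map e t)).
apply: (@card_le_of_inj _ _ f) => [t _|t t'].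
  rewrite /f ltnS -{2}(size_tuple t); elim: (tval t) => //= i s IH.
  by rewrite mulSn leq_add // -ltnS.
rewrite !inE => st st' ff; apply: val_inj; apply: (inj_map val_inj).
apply: (sorted_eq leq_trans anti_leq st st'); apply: perm_map; apply: (perm_map_inj eI).
by apply: (Bk_perm BA) ff; rewrite ?size_map ?size_tuple // => _ /mapP[i _ ->].
Qed.

(** Raising [m] by one multiplies the binomial by [(k + m + 2) / (m + 2)], which is at least 2 as
    long as [m + 1 < k]. *)
Lemma bin_lower_bound k m : m < k -> k.+1 * 2 ^ m <= 'C(k + m.+1, k).
Proof.
elim: m => [|m IH] mk; first by rewrite expn0 muln1 addn1 binSn.
have := mul_bin_down (k + m.+2) k; rewrite (_ : (k + m.+2).-1 = k + m.+1) ?addnS //.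
rewrite (_ : (k + m).+2 - k = m.+2); last by lia.
have := IH (ltnW mk); rewrite expnS addnS; set X := 2 ^ m; set C := 'C(_, k); set C' := 'C(_, k).
move=> h e; have : m.+2 * (2 * C) <= m.+2 * C' by rewrite -e; nia.
by rewrite leq_pmul2l //; lia.
Qed.

(** With [m + 2] elements the two preceding bounds give [(k + 1) * 2 ^ m <= k * n + 1 <= (k + 1) *
    n]; the factor 4 accounts for the two remaining elements. *)
Lemma Bk_card_exp_bound k n (A : {set 'I_n.+1}) :
  0 < k -> 0 < n -> Bk k A -> #|A| <= k -> 2 ^ #|A| <= 4 * n.
Proof.
case cA: #|A| => [|[|m]] k0 n0 BA; try lia.
move=> mk; have := Bk_card_bound BA cA; have := bin_lower_bound (ltnW mk).
rewrite !expnS; nia.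
Qed.

Lemma zeta_le_exp k n delta N : 0 < k -> N < k -> 2 ^ N <= 4 * n ->
  zeta k delta <= n * 4 ^ (k - N).
Proof.
case: k => // k _ Nk nN.
apply: leq_trans (zeta_le_card delta (ltn0Sn k)) _.
apply: leq_trans (card_sign_patterns_le k delta) _.
rewrite -(leq_pmul2l (isT : 0 < 4)) mulnA.
apply: leq_trans (leq_mul nN (leqnn _)).
(* All factors are now powers of 2, and the exponents compare because [k - N] is at least 1 for the
   original [k]. *)
rewrite -[4]/(2 ^ 2) -expnM -!expnD leq_exp2l //; lia.
Qed.

(* Real estimates with the exponential function *)
From Stdlib Require Import Reals Lra.

Lemma exp_chord (c : R) : (0 <= c <= 1 -> exp c <= 1 + c * (exp 1 - 1))%R.
Proof.
move=> c01; have pc := exp_pos c.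
(* The tangent line of [exp] at [c] lies below [exp] at both [0] and [1]. *)
have t0 : (exp c * (1 - c) <= 1)%R.
  have e : (1 = exp c * exp (- c))%R by rewrite -exp_plus Rplus_opp_r exp_0.
  by rewrite {2}e; apply: Rmult_le_compat_l; [lra|have := exp_ineq1_le (- c); lra].
have t1 : (exp c * (2 - c) <= exp 1)%R.
  have -> : exp 1 = (exp c * exp (1 - c))%R by rewrite -exp_plus; congr exp; lra.
  by apply: Rmult_le_compat_l; [lra|have := exp_ineq1_le (1 - c); lra].
have := Rmult_le_compat_l (1 - c) _ _ _ t0; have := Rmult_le_compat_l c _ _ _ t1; lra.
Qed.

Lemma exp1_ge2 : (2 <= exp 1)%R.
Proof. by have := exp_ineq1_le 1; lra. Qed.

Lemma pow_le_exp (x : R) k : (0 <= 1 + x -> (1 + x) ^ k <= exp (INR k * x))%R.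
Proof.
move=> x0; elim: k => [|k IH]; first by rewrite Rmult_0_l exp_0 /=; lra.
have -> : (INR k.+1 * x = x + INR k * x)%R by rewrite S_INR; ring.
rewrite exp_plus -tech_pow_Rmult.
by apply: Rmult_le_compat => //; [exact: pow_le|exact: exp_ineq1_le].
Qed.

(** Induction: with [u = t + K / e] and [c = K / (e u)], the left side grows at most by the factor
    [exp c * (u + 1 / e)]. The chord bound gives [exp c * u <= t + K], and [exp c / e <= 1], so this
    is at most the new factor [t + K + 1]. *)
Lemma ffact_ge_pow t k : ((INR t + INR k / exp 1) ^ k <= INR ((t + k) ^_ k))%R.
Proof.
have e2 := exp1_ge2; have t0 := pos_INR t.
elim: k => [|k IH]; first by rewrite ffactn0 /=; lra.
rewrite addnS ffactSS mult_INR.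
(* The step from 0 to 1 is separate, since [u] may vanish there and [c] divides by it. *)
case: k IH => [|k] IH.
  rewrite ffactn0 addn0 !S_INR /=.
  have : (/ exp 1 <= 1)%R by rewrite -[X in (_ <= X)%R]Rinv_1; apply: Rinv_le_contravar; lra.
  by lra.
set K := k.+1 in IH *; set u := (INR t + INR K / exp 1)%R in IH.
have K0 : (0 < INR K)%R by rewrite /K S_INR; have := pos_INR k; lra.
have ie : (0 < / exp 1)%R by apply: Rinv_0_lt_compat; lra.
have Ke : (0 < INR K / exp 1)%R by apply: Rmult_lt_0_compat.
have u0 : (0 < u)%R by rewrite /u; lra.
have -> : (INR t + INR K.+1 / exp 1 = u + / exp 1)%R by rewrite S_INR /u; field; lra.
set c := (INR K / exp 1 / u)%R.
have cu : (c * u = INR K / exp 1)%R by rewrite /c; field; lra.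
have c1 : (0 <= c <= 1)%R.
  split; first by apply: Rlt_le; apply: Rmult_lt_0_compat => //; apply: Rinv_0_lt_compat.
  by apply: (Rmult_le_reg_r u) => //; rewrite cu /u; lra.
have b1 : ((u + / exp 1) ^ K <= u ^ K * exp c)%R.
  have -> : (u + / exp 1 = u * (1 + / (exp 1 * u)))%R by field; lra.
  rewrite Rpow_mult_distr; apply: Rmult_le_compat_l; first by apply: pow_le; lra.
  have -> : c = (INR K * / (exp 1 * u))%R by rewrite /c; field; lra.
  apply: pow_le_exp; have : (0 < / (exp 1 * u))%R; last by lra.
  by apply: Rinv_0_lt_compat; apply: Rmult_lt_0_compat; lra.
have b2 : (exp c * (u + / exp 1) <= INR (t + K).+1)%R.
  have ch := exp_chord c1.
  have m1 : (exp c * / exp 1 <= 1)%R.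
    rewrite -exp_Ropp -exp_plus -[X in (_ <= X)%R]exp_0.
    by case: (Req_dec (c + - (1)) 0) => [->|ne]; [lra|apply/Rlt_le/exp_increasing; lra].
  have m2 := Rmult_le_compat_r u _ _ (Rlt_le _ _ u0) ch.
  have : (INR K / exp 1 * exp 1 = INR K)%R by field; lra.
  rewrite -cu S_INR plus_INR => cue.
  have : u = (INR t + c * u)%R by rewrite cu.
  nra.
rewrite [((_) ^ K.+1)%R]/=.
have p0 : (0 <= u ^ K)%R by apply: pow_le; lra.
have s0 : (0 < u + / exp 1)%R by lra.
apply: Rle_trans (_ : ((u + / exp 1) * (u ^ K * exp c) <= _)%R).
  by apply: Rmult_le_compat_l => //; lra.
have -> : ((u + / exp 1) * (u ^ K * exp c) = (exp c * (u + / exp 1)) * u ^ K)%R by ring.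
by apply: Rmult_le_compat => //; apply: Rmult_le_pos; [apply: Rlt_le; exact: exp_pos|lra].
Qed.

(** A nonpositive [a] is below every value of [Rpower]; this disposes of sets with at most
    [(1 - 1 / e) * k] elements. *)
Lemma le_Rpower_root (a X : R) k :
  (0 < X)%R -> 0 < k -> (0 < a -> a ^ k <= X)%R -> (a <= Rpower X (1 / INR k))%R.
Proof.
move=> X0 k0 h; case: (Rle_lt_dec a 0) => a0.
  by apply: Rle_trans a0 (Rlt_le _ _ (exp_pos _)).
have K0 : (0 < INR k)%R by apply: lt_0_INR; exact/ssrnat.ltP.
have -> : a = Rpower (a ^ k) (1 / INR k).
  rewrite -Rpower_pow // Rpower_mult (_ : INR k * _ = 1)%R ?Rpower_1 //; field; lra.
apply: Rle_Rpower_l; first by apply: Rlt_le; apply: Rdiv_lt_0_compat; lra.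
by split; [apply: pow_lt|exact: h].
Qed.

(** From [e >= 2] one gets [exp e >= exp 2 >= 4]. *)
Lemma pow4_le_exp m : (4 ^ m <= exp (INR m * exp 1))%R.
Proof.
have e2 := exp1_ge2.
have e4 : (4 <= exp (exp 1))%R.
  apply: Rle_trans (_ : exp 2 <= _)%R.
    have -> : (2 = 1 + 1)%R by lra.
    by rewrite exp_plus; nra.
  by case: (Req_dec (exp 1) 2) => [->|ne]; [lra|apply/Rlt_le/exp_increasing; lra].
elim: m => [|m IH]; first by rewrite Rmult_0_l exp_0 /=; lra.
have -> : (INR m.+1 * exp 1 = exp 1 + INR m * exp 1)%R by rewrite S_INR; ring.
rewrite exp_plus -tech_pow_Rmult.
by apply: Rmult_le_compat => //; [|apply: pow_le]; lra.
Qed.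

(** * Assembling the bound on the size of a B_k-sequence *)

Lemma INR_le m p : m <= p -> (INR m <= INR p)%R.
Proof. by move=> h; apply: le_INR; exact/ssrnat.leP. Qed.

Lemma INR_expn m p : INR (expn m p) = (INR m ^ p)%R.
Proof. by elim: p => // p IH; rewrite expnS mult_INR IH. Qed.

Lemma Bk_root_bound k n delta (A : {set 'I_n.+1}) :
  0 < k -> 0 < n -> 0 < delta -> Bk k A ->
  let a := (INR #|A| - (exp 1 - 1) / exp 1 * INR k)%R in
  (0 < a -> a ^ k <= INR delta * (1 + INR (tau k)) * INR k`! / INR (zeta k delta) * INR n)%R.
Proof.
move=> k0 n0 d0 BA a a0.
have e2 := exp1_ge2.
have z0 : (0 < INR (zeta k delta))%R by apply: lt_0_INR; apply/ssrnat.ltP; exact: zeta_gt0.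
have f0 : (0 < INR k`!)%R by apply: lt_0_INR; apply/ssrnat.ltP; exact: fact_gt0.
have K0 : (0 < INR k)%R by apply: lt_0_INR; exact/ssrnat.ltP.
have D1 : (1 <= INR delta)%R by apply: (INR_le d0).
have T0 := pos_INR (tau k).
have N0 := pos_INR n.
suff h : (INR (zeta k delta) * a ^ k <= INR delta * (1 + INR (tau k)) * INR k`! * INR n)%R.
  apply: (Rmult_le_reg_l (INR (zeta k delta))) => //.
  by apply: Rle_trans h _; right; field; lra.
case: (leqP k #|A|) => Ak.
  have h : (zeta k delta * #|A| ^_ k <= (tau k).+1 * (delta * n) * k`!)%N.
    rewrite -bin_ffact mulnA leq_mul // mulnC.
    apply: leq_trans (card_sign_patterns k0 n0 d0 BA).
    by rewrite leq_mul2l zeta_le_card // orbT.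
  have := INR_le h; rewrite !mult_INR S_INR => hR.
  apply: Rle_trans (_ : (INR (zeta k delta) * INR (#|A| ^_ k) <= _)%R); last by lra.
  apply: Rmult_le_compat_l; first by lra.
  (* With [t = #|A| - k], the base [t + k / e] is exactly [a]. *)
  have := ffact_ge_pow (#|A| - k) k; rewrite subnK //.
  have -> // : (INR (#|A| - k) + INR k / exp 1)%R = a.
  by rewrite minus_INR; [rewrite /a; field; lra|exact/ssrnat.leP].
set m := k - #|A|.
have az : (a = INR k / exp 1 * (1 + - (INR m * exp 1 / INR k)))%R.
  by rewrite /a /m minus_INR; [field; lra|apply/ssrnat.leP; lia].
have ke0 : (0 < INR k / exp 1)%R by apply: Rdiv_lt_0_compat; lra.
have b1 : (a ^ k <= INR k`! * exp (- (INR m * exp 1)))%R.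
  rewrite az Rpow_mult_distr; apply: Rmult_le_compat.
  - by apply: pow_le; lra.
  - by apply: pow_le; move: a0; rewrite az; nra.
  (* At [t = 0] the falling factorial bound reads [(k / e) ^ k <= k!]. *)
  - by have := ffact_ge_pow 0 k; rewrite add0n ffactnn Rplus_0_l.
  have -> : (- (INR m * exp 1) = INR k * (- (INR m * exp 1 / INR k)))%R by field; lra.
  by apply: pow_le_exp; move: a0; rewrite az; nra.
have := INR_le (zeta_le_exp delta k0 Ak (Bk_card_exp_bound k0 n0 BA (ltnW Ak))).
rewrite mult_INR INR_expn -/m (_ : INR 4 = 4%R); last by rewrite /=; lra.
have := pow4_le_exp m; set q := (4 ^ m)%R => hq hz.
have E1 : (exp (INR m * exp 1) * exp (- (INR m * exp 1)) = 1)%R.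
  by rewrite -exp_plus Rplus_opp_r exp_0.
have E0 := exp_pos (- (INR m * exp 1)).
have q1 : (q * exp (- (INR m * exp 1)) <= 1)%R by rewrite -[X in (_ <= X)%R]E1; apply: Rmult_le_compat_r; lra.
have s1 : (INR (zeta k delta) * a ^ k <= INR n * q * (INR k`! * exp (- (INR m * exp 1))))%R.
  by apply: Rmult_le_compat => //; [lra|apply: pow_le; lra].
apply: Rle_trans s1 _.
have -> : (INR n * q * (INR k`! * exp (- (INR m * exp 1)))
   = INR k`! * INR n * (q * exp (- (INR m * exp 1))))%R by ring.
have kn : (0 <= INR k`! * INR n)%R by apply: Rmult_le_pos; lra.
apply: Rle_trans (_ : (INR k`! * INR n * 1 <= _)%R); first exact: Rmult_le_compat_l.
(* The factor [delta * (1 + tau)] is at least 1 and is given away here. *)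
have -> : (INR delta * (1 + INR (tau k)) * INR k`! * INR n
  = INR k`! * INR n * (INR delta * (1 + INR (tau k))))%R by ring.
by apply: Rmult_le_compat_l => //; nra.
Qed.

Theorem theorem1 (k n delta : nat) :
  (0 < k)%N -> (0 < n)%N -> (0 < delta)%N ->
  (INR (Phi k n) <=
     Rpower (INR delta * (1 + INR (tau k)) * INR (k`!) / INR (zeta k delta)) (1 / INR k)
       * Rpower (INR n) (1 / INR k)
     + (exp 1 - 1) / exp 1 * INR k)%R.
Proof.
move=> k0 n0 d0.
have e2 := exp1_ge2.
have z0 : (0 < INR (zeta k delta))%R by apply: lt_0_INR; apply/ssrnat.ltP; exact: zeta_gt0.
have f0 : (0 < INR k`!)%R by apply: lt_0_INR; apply/ssrnat.ltP; exact: fact_gt0.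
have N0 : (0 < INR n)%R by apply: lt_0_INR; exact/ssrnat.ltP.
have D0 : (0 < INR delta)%R by apply: lt_0_INR; exact/ssrnat.ltP.
have T0 := pos_INR (tau k).
have Y0 : (0 < INR delta * (1 + INR (tau k)) * INR k`! / INR (zeta k delta))%R.
  by apply: Rdiv_lt_0_compat => //; do 2!apply: Rmult_lt_0_compat => //; lra.
rewrite Rpower_mult_distr //.
have X0 := Rmult_lt_0_compat _ _ Y0 N0.
(* The first case is the value 0 of an empty maximum, below a nonnegative right-hand side. *)
rewrite /Phi; elim/big_ind: _ => [|x y hx hy|A BA].
- have c0 : (0 <= (exp 1 - 1) / exp 1)%R by apply: Rle_mult_inv_pos; lra.
  apply: Rplus_le_le_0_compat; first exact/Rlt_le/exp_pos.
  by apply: Rmult_le_pos => //; exact: pos_INR.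
- by case: (leqP x y).
have := le_Rpower_root X0 k0 (Bk_root_bound k0 n0 d0 BA); lra.
Qed.
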